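(* For every $\epsilon>0$ there is a problem instance with identical task weights ($w_1=\dots=w_n$) for which $$\min_{N\in\mathcal{N}} C(N)\;\ge\;\left(\frac{4}{3}-\epsilon\right)\min_{A\in\mathcal{A}} C(A),$$ where $\mathcal{A}$ is the set of all assignments and $\mathcal{N}$ is the set of all Nash assignments of the instance.
   Context: A problem instance $(T,R)$ consists of a set $R=\{1,\dots,m\}$ of resources with delays (positive reals) $d_1\le\dots\le d_m$ and a set $T=\{1,\dots,n\}$ of tasks with real weights $w_1,\dots,w_n\ge 1$. An assignment is a vector $A=(A_1,\dots,A_n)\in\mathcal{A}=\{1,\dots,m\}^n$ (task $i$ is assigned to resource $A_i$). The load of resource $\ell$ in $A$ is $L(\ell,A)=d_\ell\sum_{i\in T:\,A_i=\ell}w_i$, the load of task $i$ is $L(A_i,A)$, and the social cost is $C(A)=\sum_{i\in T}L(A_i,A)$. An assignment $A$ is a Nash assignment if for every task $i$ and every resource $\ell$ we have $L(A_i,A)\le L(\ell,A')$, where $A'$ is obtained from $A$ by re-assigning task $i$ to resource $\ell$ and making no other change. $\mathcal{N}=\mathcal{N}(T,R)$ is the set of all Nash assignments; it is known to be nonempty. *)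

(* Defs.v *)
From mathcomp Require Import all_boot all_order all_algebra.
From mathcomp Require Import classical_sets reals.

Set Implicit Arguments.
Unset Strict Implicit.
Unset Printing Implicit Defensive.

Import Order.TTheory GRing.Theory Num.Theory.
Local Open Scope ring_scope.
Local Open Scope classical_set_scope.

(* Resources and tasks are numbered from 0.  Both sets are required to be
   nonempty: without tasks every cost is 0, and comparing costs is vacuous. *)
Record instance (R : realType) := Instance {
  nres : nat;
  ntask : nat;
  nres_gt0 : (0 < nres)%N;
  ntask_gt0 : (0 < ntask)%N;
  delay : 'I_nres -> R;
  delay_gt0 : forall l, 0 < delay l;
  delay_nondecreasing : forall k l : 'I_nres, (k <= l)%N -> delay k <= delay l;
  weight : 'I_ntask -> R;
  weight_ge1 : forall i, 1 <= weight i
}.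

Definition identical_weights (R : realType) (I : instance R) : Prop :=
  forall i j : 'I_(ntask I), weight i = weight j.

Definition assignment (R : realType) (I : instance R) : Type :=
  {ffun 'I_(ntask I) -> 'I_(nres I)}.

Definition load (R : realType) (I : instance R)
    (l : 'I_(nres I)) (A : assignment I) : R :=
  delay l * \sum_(i | A i == l) weight i.

Definition cost (R : realType) (I : instance R) (A : assignment I) : R :=
  \sum_i load (A i) A.

Definition reassign (R : realType) (I : instance R)
    (A : assignment I) (i : 'I_(ntask I)) (l : 'I_(nres I)) : assignment I :=
  [ffun j => if j == i then l else A j].

Definition nash (R : realType) (I : instance R) (A : assignment I) : Prop :=
  forall (i : 'I_(ntask I)) (l : 'I_(nres I)),
    load (A i) A <= load l (reassign A i l).

(* The minimum is attained: [is_min S v] never holds when [S] is empty. *)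
Definition is_min (R : realType) (S : set R) (v : R) : Prop :=
  S v /\ lbound S v.

(* Main.v *)
(** Pigou's example.  Take [2k] unit tasks, one resource of delay [1] and [k]
    resources of delay [2k + 1].  A single task on a slow resource has load
    [2k + 1], more than the fast resource with all the tasks, so the only Nash
    assignment uses the fast resource alone and costs [4 k ^ 2].  Moving [k]
    tasks to distinct slow resources costs [k ^ 2 + k (2k + 1) = 3 k ^ 2 + k],
    and the ratio tends to [4 / 3]. *)
Require Import Defs.
From mathcomp Require Import all_boot all_order all_algebra.
From mathcomp Require Import classical_sets reals.
From mathcomp Require Import ring lra.

Import Order.TTheory GRing.Theory Num.Theory.
Local Open Scope ring_scope.
Local Open Scope classical_set_scope.

Lemma is_min_cost_exists (R : realType) (I : instance R) :
  exists v : R, is_min [set cost A | A in [set: assignment I]] v.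
Proof.
pose A1 : assignment I := [ffun=> Ordinal (nres_gt0 I)].
case: (@Order.TotalTheory.arg_minP _ _ _ A1 predT (@cost R I) isT) => A0 _ minA0.
by exists (cost A0); split=> [|_ [A _ <-]]; [exists A0 | apply: minA0].
Qed.

Section Pigou.
Variables (R : realType) (k : nat).
Hypothesis k_gt0 : (0 < k)%N.

(** The [+ 1] in the slow delay avoids a tie: with delay [k + k], putting a single task on a slow
    resource would also be a Nash assignment. *)
Definition pigou_delay (l : 'I_k.+1) : R :=
  if l == ord0 then 1 else (k + k).+1%:R.

Lemma pigou_delay_gt0 l : 0 < pigou_delay l.
Proof. by rewrite /pigou_delay; case: ifP => _; rewrite ?ltr01 ?ltr0Sn. Qed.

Lemma pigou_delay_nondecreasing (l l' : 'I_k.+1) :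
  (l <= l')%N -> pigou_delay l <= pigou_delay l'.
Proof.
rewrite /pigou_delay -!val_eqE /=.
by case: (val l) (val l') => [|a] [|b] //= _; rewrite ler1n.
Qed.

Lemma pigou_ntask_gt0 : (0 < k + k)%N.
Proof. by rewrite addn_gt0 k_gt0. Qed.

Definition pigou : instance R :=
  @Instance R k.+1 (k + k) (ltn0Sn k) pigou_ntask_gt0
    pigou_delay pigou_delay_gt0 pigou_delay_nondecreasing
    (fun=> 1) (fun=> lexx 1).

(** The unit weight of task [i] alone already contributes the whole slow delay. *)
Lemma pigou_load_slow (A : assignment pigou) i :
  A i != ord0 -> (k + k).+1%:R <= load (A i) A.
Proof.
move=> /negPf Ai; rewrite /load /= /pigou_delay Ai ler_peMr ?ler0n//.
by rewrite (bigD1 i) //= lerDl sumr_ge0.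
Qed.

Lemma pigou_load_fast_le (A : assignment pigou) :
  load (ord0 : 'I_(nres pigou)) A <= (k + k)%:R.
Proof.
rewrite /load /= /pigou_delay eqxx mul1r.
by rewrite sumr_const ler_nat (leq_trans (max_card _)) // card_ord.
Qed.

Definition all_fast : assignment pigou := [ffun=> ord0].

Lemma nash_pigouP (A : assignment pigou) : nash A <-> A = all_fast.
Proof.
have lt_slow : (k + k)%:R < (k + k).+1%:R :> R by rewrite ltr_nat.
split=> [nashA | -> i l].
  apply/ffunP => i; rewrite ffunE; apply/eqP/negP => /negP Ai.
  have := le_trans (pigou_load_slow _ _ Ai) (nashA i ord0).
  by move=> /le_trans/(_ (pigou_load_fast_le _)); rewrite leNgt lt_slow.
(* A move to the fast resource changes nothing; after a move to a slow one, [pigou_load_slow]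
   applies to the new assignment. *)
have [-> | l_slow] := eqVneq l ord0.
  rewrite [reassign _ _ _](_ : _ = all_fast) ?ffunE //.
  by apply/ffunP => j; rewrite !ffunE if_same.
rewrite {1}/all_fast ffunE (le_trans (pigou_load_fast_le _)) // ltW //.
apply: (lt_le_trans lt_slow).
have Ei : reassign all_fast i l i = l by rewrite ffunE eqxx.
by have := pigou_load_slow (reassign all_fast i l) i; rewrite Ei; apply.
Qed.

Lemma cost_all_fast : cost all_fast = (k + k)%:R ^+ 2.
Proof.
have load_fast i : load (all_fast i) all_fast = (k + k)%:R.
  rewrite /load /= ffunE /pigou_delay eqxx mul1r.
  under eq_bigl do rewrite ffunE eqxx.
  by rewrite sumr_const card_ord.
by rewrite /cost (eq_bigr _ (fun i _ => load_fast i)) sumr_const card_ord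
           -[LHS]mulr_natr expr2.
Qed.

(** Counting the tasks as [k + k] lets [split] separate the two halves, and the injection
    [lift ord0] gives each slow resource exactly one task. *)
Definition half_fast : assignment pigou :=
  [ffun i : 'I_(k + k) => if split i is inr j then lift ord0 j else ord0].

Lemma half_fast_lshift j : half_fast (lshift k j) = ord0.
Proof. by rewrite ffunE (unsplitK (inl j)). Qed.

Lemma half_fast_rshift j : half_fast (rshift k j) = lift ord0 j.
Proof. by rewrite ffunE (unsplitK (inr j)). Qed.

Lemma cost_half_fast : cost half_fast = 3 * k%:R ^+ 2 + k%:R.
Proof.
have loadE l : load l half_fast =
    pigou_delay l * ((\sum_(j < k) if ord0 == l then 1 else 0) +
                     (\sum_(j < k) if lift ord0 j == l then 1 else 0)).
  rewrite /load /= big_mkcond big_split_ord /=.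
  by congr (_ * (_ + _)); apply: eq_bigr => j _;
    rewrite ?half_fast_lshift ?half_fast_rshift.
have load_fast : load (ord0 : 'I_(nres pigou)) half_fast = k%:R.
  rewrite loadE /pigou_delay eqxx mul1r sumr_const card_ord.
  by rewrite big1 ?addr0.
have load_slow j : load (lift ord0 j : 'I_(nres pigou)) half_fast
    = (k + k).+1%:R.
  rewrite loadE /pigou_delay /= big1 // add0r (bigD1 j) //= eqxx big1
    => [|i /negPf ij].
    by rewrite addr0 mulr1.
  by rewrite (inj_eq lift_inj) ij.
rewrite /cost big_split_ord /=.
under eq_bigr do rewrite half_fast_lshift load_fast.
under [X in _ + X]eq_bigr do rewrite half_fast_rshift load_slow.
rewrite !sumr_const card_ord -[X in X + _]mulr_natr -[X in _ + X]mulr_natr -addn1 !natrD.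
ring.
Qed.

End Pigou.

Theorem lemma4p6 (R : realType) (eps : R) (eps_gt0 : 0 < eps) :
  exists I : instance R,
    identical_weights I /\
    exists minN minA : R,
      [/\ is_min [set cost N | N in [set N : assignment I | nash N]] minN,
          is_min [set cost A | A in [set: assignment I]] minA
        & minN >= (4 / 3 - eps) * minA].
Proof.
(* Any [k] above [1 / eps] works. *)
pose k := (Num.truncn eps^-1).+1.
have k_gt0 : (0 < k)%N by [].
have eps_k : 1 < eps * k%:R.
  by rewrite mulrC -ltr_pdivrMr // div1r truncnS_gt.
exists (pigou R k k_gt0); split=> //.
have [minA [minA_cost minA_le]] := is_min_cost_exists _ (pigou R k k_gt0).
exists (cost (all_fast R k k_gt0)), minA; split=> //.
  split; first by exists (all_fast R k k_gt0); first exact/nash_pigouP.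
  by move=> _ [N /nash_pigouP -> <-].
(* The optimum is never computed: an upper bound on it suffices. *)
have leA : minA <= cost (half_fast R k k_gt0).
  by apply: minA_le; exists (half_fast R k k_gt0).
rewrite cost_half_fast in leA; rewrite cost_all_fast natrD.
(* Multiplying [leA] by the factor needs its sign; a negative factor makes the bound trivial, since
   costs are nonnegative. *)
have [eps_small | eps_big] := leP 0 (4 / 3 - eps).
  apply: (le_trans (ler_wpM2l eps_small leA)).
  have k0 : 0 < k%:R :> R by rewrite ltr0n.
  (* After expansion the goal is [4 k / 3 <= 3 eps k ^ 2 + eps k], linear in the monomials bounded
     here. *)
  have kk : k%:R < eps * k%:R ^+ 2 by rewrite expr2 mulrA ltr_pMl.
  have ek : 0 < eps * k%:R by rewrite mulr_gt0.
  lra.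
apply: (@le_trans _ _ 0); last exact: sqr_ge0.
rewrite nmulr_rle0 //; case: minA_cost => A _ <-; apply: sumr_ge0 => i _.
by rewrite mulr_ge0 ?sumr_ge0 // ltW // pigou_delay_gt0.
Qed.
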